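(* Let $E$ be a finite directed graph and let $L_K(E)$ be its Leavitt path algebra over a field $K$. Then all ideals of $L_K(E)$ are graded if and only if $E$ satisfies Condition (K).
   Context: A directed graph $E=(E^0,E^1,r,s)$ consists of a set $E^0$ of vertices, a set $E^1$ of edges, and range and source maps $r,s:E^1\to E^0$. It is finite if $E^0$ and $E^1$ are finite. For each $e\in E^1$ there is a ghost edge $e^*$ with $s(e^* )=r(e)$, $r(e^* )=s(e)$; let $(E^1)^*=\{e^*: e\in E^1\}$. The Leavitt path algebra $L_K(E)$ is the free (associative) $K$-algebra generated by $E^0\cup E^1\cup (E^1)^*$ subject to the relations: (V) $vw=0$ if $v\ne w$ and $vv=v$, for $v,w\in E^0$; (E1) $e\,r(e)=s(e)\,e=e$ for $e\in E^1$; (E2) $e^*s(e)=r(e)e^*=e^*$ for $e\in E^1$; (CK1) $e^*f=0$ if $e\neq f$ and $e^*e=r(e)$, for $e,f\in E^1$; (CK2) $v=\sum_{e\in E^1,\,s(e)=v}ee^*$ for every $v\in E^0$ with $s^{-1}(v)\ne\varnothing$. A path is a product $e_1\cdots e_n$ of edges with $r(e_i)=s(e_{i+1})$; vertices are regarded as paths of degree $0$, and $\deg(e_1\cdots e_n)=n$, $(e_1\cdots e_n)^*=e_n^*\cdots e_1^*$. A closed path is a path $e_1\cdots e_n$ with $n\ge 1$ and $s(e_1)=r(e_n)$. A closed simple path based at $v$ is a closed path $e_1\cdots e_n$ with $s(e_1)=v$ and $s(e_i)\neq s(e_1)$ for $i=2,\dots,n$. $E$ satisfies Condition (K) if for every $v\in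 E^0$ there are either zero or at least two closed simple paths based at $v$. $L_K(E)$ is $\mathbb{Z}$-graded, $L_K(E)=\bigoplus_{i\in\mathbb{Z}}A_i$, where $A_i$ is spanned by the elements $\alpha\beta^*$ with $\alpha,\beta$ paths, $r(\alpha)=r(\beta)$ and $\deg(\alpha)-\deg(\beta)=i$. Ideals are two-sided. An ideal $I$ is graded if for every $y\in I$ with homogeneous decomposition $y=\sum_i y_i$, $y_i\in A_i$, each $y_i\in I$. *)

(* Defs.v *)
From HB Require Import structures.
From mathcomp Require Import all_boot all_algebra.
From mathcomp Require Import boolp classical_sets.

Set Implicit Arguments.
Unset Strict Implicit.
Unset Printing Implicit Defensive.

Import GRing.Theory.
Local Open Scope ring_scope.
Local Open Scope quotient_scope.

Record digraph := Digraph {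
  vertex : finType;
  edge : finType;
  esource : edge -> vertex;
  erange : edge -> vertex
}.

Section Paths.
Variable E : digraph.
Implicit Types (v : vertex E) (e f : edge E) (p : seq (edge E)).

(* [PEdges e p] is the nonempty edge sequence e :: p; it is a path of E only
   when [is_path] holds. *)
Inductive gpath := PVertex of vertex E | PEdges of edge E & seq (edge E).
Implicit Types a : gpath.

Definition is_path a : bool :=
  if a is PEdges e p then path (fun e f => erange e == esource f) e p else true.

Definition psource a : vertex E :=
  match a with PVertex v => v | PEdges e _ => esource e end.

Definition prange a : vertex E :=
  match a with PVertex v => v | PEdges e p => erange (last e p) end.

Definition pdeg a : nat :=
  match a with PVertex _ => 0%N | PEdges _ p => (size p).+1 end.

Definition closed_path a : bool :=
  [&& is_path a, (0 < pdeg a)%N & psource a == prange a].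

Definition closed_simple_path v a : bool :=
  [&& closed_path a, psource a == v &
      if a is PEdges e p then all (fun f => esource f != esource e) p
      else false].

Definition condition_K : Prop :=
  forall v, (forall a, ~ closed_simple_path v a) \/
    (exists a b, [/\ a <> b, closed_simple_path v a & closed_simple_path v b]).

End Paths.

(* The free algebra in the presentation of L_K(E) is the non-unital one: in the
   unital free algebra the same relations would leave 1 - \sum_v v as an extra
   nonzero central idempotent. It is presented here by terms modulo the
   congruence [lpa_eq], generated by the laws of associative K-algebras and by
   the defining relations; the unit \sum_v v of L_K(E) is then derived. *)
Section Terms.
Variables (K : fieldType) (E : digraph).

Inductive lterm :=
  | TVertex of vertex E
  | TEdge of edge E
  | TGhost of edge E
  | TZero
  | TOpp of lterm
  | TAdd of lterm & lterm
  | TMul of lterm & lterm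
  | TScale of K & lterm.

Inductive lpa_eq : lterm -> lterm -> Prop :=
  | LRefl x : lpa_eq x x
  | LSym x y : lpa_eq x y -> lpa_eq y x
  | LTrans y x z : lpa_eq x y -> lpa_eq y z -> lpa_eq x z
  | LOpp x x' : lpa_eq x x' -> lpa_eq (TOpp x) (TOpp x')
  | LAdd x x' y y' :
      lpa_eq x x' -> lpa_eq y y' -> lpa_eq (TAdd x y) (TAdd x' y')
  | LMul x x' y y' :
      lpa_eq x x' -> lpa_eq y y' -> lpa_eq (TMul x y) (TMul x' y')
  | LScale k x x' : lpa_eq x x' -> lpa_eq (TScale k x) (TScale k x')
  | LAddA x y z : lpa_eq (TAdd x (TAdd y z)) (TAdd (TAdd x y) z)
  | LAddC x y : lpa_eq (TAdd x y) (TAdd y x)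
  | LAdd0 x : lpa_eq (TAdd TZero x) x
  | LAddN x : lpa_eq (TAdd (TOpp x) x) TZero
  | LMulA x y z : lpa_eq (TMul x (TMul y z)) (TMul (TMul x y) z)
  | LMulDl x y z : lpa_eq (TMul (TAdd x y) z) (TAdd (TMul x z) (TMul y z))
  | LMulDr x y z : lpa_eq (TMul x (TAdd y z)) (TAdd (TMul x y) (TMul x z))
  | LScaleA k l x : lpa_eq (TScale k (TScale l x)) (TScale (k * l) x)
  | LScale1 x : lpa_eq (TScale 1 x) x
  | LScaleDr k x y :
      lpa_eq (TScale k (TAdd x y)) (TAdd (TScale k x) (TScale k y))
  | LScaleDl k l x :
      lpa_eq (TScale (k + l) x) (TAdd (TScale k x) (TScale l x))
  | LScaleAl k x y : lpa_eq (TScale k (TMul x y)) (TMul (TScale k x) y)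
  | LScaleAr k x y : lpa_eq (TScale k (TMul x y)) (TMul x (TScale k y))
  | LV_neq v w : v <> w -> lpa_eq (TMul (TVertex v) (TVertex w)) TZero
  | LV_eq v : lpa_eq (TMul (TVertex v) (TVertex v)) (TVertex v)
  | LE1_range e : lpa_eq (TMul (TEdge e) (TVertex (erange e))) (TEdge e)
  | LE1_source e : lpa_eq (TMul (TVertex (esource e)) (TEdge e)) (TEdge e)
  | LE2_source e : lpa_eq (TMul (TGhost e) (TVertex (esource e))) (TGhost e)
  | LE2_range e : lpa_eq (TMul (TVertex (erange e)) (TGhost e)) (TGhost e)
  | LCK1_neq e f : e <> f -> lpa_eq (TMul (TGhost e) (TEdge f)) TZero
  | LCK1_eq e : lpa_eq (TMul (TGhost e) (TEdge e)) (TVertex (erange e))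
  | LCK2 v : (exists e, esource e = v) ->
      lpa_eq (TVertex v)
        (\big[TAdd/TZero]_(e : edge E | esource e == v)
           TMul (TEdge e) (TGhost e)).

(* Term equality and [lpa_eq] are made boolean classically. *)
HB.instance Definition _ := gen_eqMixin lterm.
HB.instance Definition _ := gen_choiceMixin lterm.

Definition lpa_eqb : rel lterm := fun x y => `[< lpa_eq x y >].

Lemma lpa_eqb_equiv : equiv_class_of lpa_eqb.
Proof.
split=> [x | x y | y x z].
- by apply/asboolP; apply: LRefl.
- by apply/asboolP/asboolP; apply: LSym.
- by move=> /asboolP xy /asboolP yz; apply/asboolP; apply: LTrans xy yz.
Qed.

Canonical lpa_equiv_rel := EquivRelPack lpa_eqb_equiv.

Definition LPA := {eq_quot lpa_equiv_rel}.

HB.instance Definition _ : EqQuotient lterm lpa_equiv_rel LPA :=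
  EqQuotient.on LPA.
HB.instance Definition _ := Choice.on LPA.

Lemma lpa_piP x y : \pi_LPA x = \pi_LPA y <-> lpa_eq x y.
Proof. by split=> [/eqmodP/asboolP | xy] //; apply/eqmodP/asboolP. Qed.

Let pi_eq x y : lpa_eq x y -> \pi_LPA x = \pi_LPA y.
Proof. by move/lpa_piP. Qed.

Let lpa_repr (x : lterm) : lpa_eq (repr (\pi_LPA x)) x.
Proof. by apply/lpa_piP; rewrite reprK. Qed.

Definition lpa_zero : LPA := \pi_LPA TZero.
Definition lpa_opp := lift_op1 LPA TOpp.
Definition lpa_add := lift_op2 LPA TAdd.
Definition lpa_mul := lift_op2 LPA TMul.
Definition lpa_scale (k : K) := lift_op1 LPA (TScale k).

Let piN x : lpa_opp (\pi_LPA x) = \pi_LPA (TOpp x).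
Proof. by unlock lpa_opp; apply: pi_eq; apply: LOpp; apply: lpa_repr. Qed.
Let piD x y : lpa_add (\pi_LPA x) (\pi_LPA y) = \pi_LPA (TAdd x y).
Proof. by unlock lpa_add; apply: pi_eq; apply: LAdd; apply: lpa_repr. Qed.
Let piM x y : lpa_mul (\pi_LPA x) (\pi_LPA y) = \pi_LPA (TMul x y).
Proof. by unlock lpa_mul; apply: pi_eq; apply: LMul; apply: lpa_repr. Qed.
Let piZ k x : lpa_scale k (\pi_LPA x) = \pi_LPA (TScale k x).
Proof. by unlock lpa_scale; apply: pi_eq; apply: LScale; apply: lpa_repr. Qed.

Let lpa_addA : associative lpa_add.
Proof.
by elim/quotW=> x; elim/quotW=> y; elim/quotW=> z;
   rewrite !piD; apply: pi_eq; apply: LAddA.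
Qed.
Let lpa_addC : commutative lpa_add.
Proof.
by elim/quotW=> x; elim/quotW=> y; rewrite !piD; apply: pi_eq; apply: LAddC.
Qed.
Let lpa_add0 : left_id lpa_zero lpa_add.
Proof. by elim/quotW=> x; rewrite !piD; apply: pi_eq; apply: LAdd0. Qed.
Let lpa_addN : left_inverse lpa_zero lpa_opp lpa_add.
Proof. by elim/quotW=> x; rewrite piN piD; apply: pi_eq; apply: LAddN. Qed.

HB.instance Definition _ :=
  GRing.isZmodule.Build LPA lpa_addA lpa_addC lpa_add0 lpa_addN.

Lemma lpa_pi0 : \pi_LPA TZero = 0. Proof. by []. Qed.
Lemma lpa_piN x : \pi_LPA (TOpp x) = - \pi_LPA x.
Proof. by rewrite -piN. Qed.
Lemma lpa_piD x y : \pi_LPA (TAdd x y) = \pi_LPA x + \pi_LPA y.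
Proof. by rewrite -piD. Qed.

Definition lpa_vertex (v : vertex E) : LPA := \pi_LPA (TVertex v).
Definition lpa_edge (e : edge E) : LPA := \pi_LPA (TEdge e).
Definition lpa_ghost (e : edge E) : LPA := \pi_LPA (TGhost e).

Definition lpa_one : LPA := \sum_(v : vertex E) lpa_vertex v.

Let lpa_mulA : associative lpa_mul.
Proof.
by elim/quotW=> x; elim/quotW=> y; elim/quotW=> z;
   rewrite !piM; apply: pi_eq; apply: LMulA.
Qed.
Let lpa_mulDl : left_distributive lpa_mul +%R.
Proof.
by elim/quotW=> x; elim/quotW=> y; elim/quotW=> z;
   rewrite !(piM, =^~ lpa_piD); apply: pi_eq; apply: LMulDl.
Qed.
Let lpa_mulDr : right_distributive lpa_mul +%R.
Proof.
by elim/quotW=> x; elim/quotW=> y; elim/quotW=> z;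
   rewrite !(piM, =^~ lpa_piD); apply: pi_eq; apply: LMulDr.
Qed.

Let lpa_mulr0 x : lpa_mul x 0 = 0.
Proof. by apply: (@addrI _ (lpa_mul x 0)); rewrite -lpa_mulDr !addr0. Qed.
Let lpa_mul0r x : lpa_mul 0 x = 0.
Proof. by apply: (@addrI _ (lpa_mul 0 x)); rewrite -lpa_mulDl !addr0. Qed.
Let lpa_mulrN x y : lpa_mul x (- y) = - lpa_mul x y.
Proof.
by apply: (@addrI _ (lpa_mul x y)); rewrite -lpa_mulDr !subrr lpa_mulr0.
Qed.
Let lpa_mulNr x y : lpa_mul (- x) y = - lpa_mul x y.
Proof.
by apply: (@addrI _ (lpa_mul x y)); rewrite -lpa_mulDl !subrr lpa_mul0r.
Qed.

Let lpa_scaleAl k x y : lpa_scale k (lpa_mul x y) = lpa_mul (lpa_scale k x) y.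
Proof.
elim/quotW: x => x; elim/quotW: y => y.
by rewrite piM !piZ piM; apply: pi_eq; apply: LScaleAl.
Qed.
Let lpa_scaleAr k x y : lpa_scale k (lpa_mul x y) = lpa_mul x (lpa_scale k y).
Proof.
elim/quotW: x => x; elim/quotW: y => y.
by rewrite piM !piZ piM; apply: pi_eq; apply: LScaleAr.
Qed.

Let lv_mul v w :
  lpa_mul (lpa_vertex v) (lpa_vertex w) = if v == w then lpa_vertex v else 0.
Proof.
rewrite /lpa_vertex piM; case: eqP => [<-|vw].
  by apply: pi_eq; apply: LV_eq.
by apply: pi_eq; apply: LV_neq.
Qed.

Let one_lv v : lpa_mul lpa_one (lpa_vertex v) = lpa_vertex v.
Proof.
rewrite /lpa_one (big_morph (lpa_mul^~ (lpa_vertex v))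
  (fun x y => lpa_mulDl x y _) (lpa_mul0r _)) (bigD1 v) //=.
rewrite lv_mul eqxx big1 ?addr0 // => w wv.
by rewrite lv_mul (negPf wv).
Qed.

Let lv_one v : lpa_mul (lpa_vertex v) lpa_one = lpa_vertex v.
Proof.
rewrite /lpa_one.
rewrite (big_morph (lpa_mul (lpa_vertex v)) (lpa_mulDr _) (lpa_mulr0 _)).
rewrite (bigD1 v) //= lv_mul eqxx big1 ?addr0 // => w wv.
by rewrite lv_mul eq_sym (negPf wv).
Qed.

Let lpa_mul1 : left_id lpa_one lpa_mul.
Proof.
elim/quotW; elim=> [v|e|e||x IH|x IHx y IHy|x IHx y _|k x IH].
- exact: one_lv.
- by rewrite -(pi_eq (LE1_source e)) -piM lpa_mulA one_lv.
- by rewrite -(pi_eq (LE2_range e)) -piM lpa_mulA one_lv.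
- exact: lpa_mulr0.
- by rewrite lpa_piN lpa_mulrN IH.
- by rewrite lpa_piD lpa_mulDr IHx IHy.
- by rewrite -piM lpa_mulA IHx.
- by rewrite -piZ -lpa_scaleAr IH.
Qed.

Let lpa_mulr1 : right_id lpa_one lpa_mul.
Proof.
elim/quotW; elim=> [v|e|e||x IH|x IHx y IHy|x _ y IHy|k x IH].
- exact: lv_one.
- by rewrite -(pi_eq (LE1_range e)) -piM -lpa_mulA lv_one.
- by rewrite -(pi_eq (LE2_source e)) -piM -lpa_mulA lv_one.
- exact: lpa_mul0r.
- by rewrite lpa_piN lpa_mulNr IH.
- by rewrite lpa_piD lpa_mulDl IHx IHy.
- by rewrite -piM -lpa_mulA IHy.
- by rewrite -piZ -lpa_scaleAl IH.
Qed.

(* Not an nzRingType: L_K(E) = 0 when E has no vertex. *)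
HB.instance Definition _ := GRing.Zmodule_isPzRing.Build LPA
  lpa_mulA lpa_mul1 lpa_mulr1 lpa_mulDl lpa_mulDr.

Let lpa_scaleA k l x : lpa_scale k (lpa_scale l x) = lpa_scale (k * l) x.
Proof. by elim/quotW: x => x; rewrite !piZ; apply: pi_eq; apply: LScaleA. Qed.
Let lpa_scale1 : left_id 1 lpa_scale.
Proof. by elim/quotW=> x; rewrite !piZ; apply: pi_eq; apply: LScale1. Qed.
Let lpa_scaleDr : right_distributive lpa_scale +%R.
Proof.
move=> k; elim/quotW=> x; elim/quotW=> y.
by rewrite -lpa_piD !piZ -lpa_piD; apply: pi_eq; apply: LScaleDr.
Qed.
Let lpa_scaleDl x : {morph lpa_scale^~ x : k l / k + l}.
Proof.
move=> k l; elim/quotW: x => x /=.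
by rewrite !piZ -lpa_piD; apply: pi_eq; apply: LScaleDl.
Qed.

HB.instance Definition _ := GRing.Zmodule_isLmodule.Build K LPA
  lpa_scaleA lpa_scale1 lpa_scaleDr lpa_scaleDl.

Lemma lpa_piM x y : \pi_LPA (TMul x y) = \pi_LPA x * \pi_LPA y.
Proof. by rewrite -piM. Qed.
Lemma lpa_piZ k x : \pi_LPA (TScale k x) = k *: \pi_LPA x.
Proof. by rewrite -piZ. Qed.
Lemma lpa_oneE : 1 = \sum_(v : vertex E) lpa_vertex v :> LPA. Proof. by []. Qed.
Lemma scale_lpaAl (k : K) (x y : LPA) : k *: (x * y) = (k *: x) * y.
Proof. exact: lpa_scaleAl. Qed.
Lemma scale_lpaAr (k : K) (x y : LPA) : k *: (x * y) = x * (k *: y).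
Proof. exact: lpa_scaleAr. Qed.

Definition path_elt (a : gpath E) : LPA :=
  match a with
  | PVertex v => lpa_vertex v
  | PEdges e p => \prod_(f <- e :: p) lpa_edge f
  end.

Definition path_star (a : gpath E) : LPA :=
  match a with
  | PVertex v => lpa_vertex v
  | PEdges e p => \prod_(f <- rev (e :: p)) lpa_ghost f
  end.

Definition component (i : int) : set LPA := fun x =>
  exists n (k : 'I_n -> K) (a b : 'I_n -> gpath E),
    (forall j, [/\ is_path (a j), is_path (b j), prange (a j) = prange (b j) &
                   (pdeg (a j))%:Z - (pdeg (b j))%:Z = i]) /\
    x = \sum_(j < n) k j *: (path_elt (a j) * path_star (b j)).

Definition graded (I : set LPA) : Prop :=
  forall (s : seq int) (y : int -> LPA), uniq s ->
    (forall i, component i (y i)) -> I (\sum_(i <- s) y i) ->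
    forall i, i \in s -> I (y i).

End Terms.

Definition ideal (A : pzRingType) (I : set A) : Prop :=
  [/\ I 0, forall x y, I x -> I y -> I (x - y),
      forall a x, I x -> I (a * x) & forall a x, I x -> I (x * a)].

(* Main.v *)
(** If Condition (K) fails at v, let c be the only closed simple path at v. An
    infinite path from v that ends in c c c ... must be c c c ... itself, so c
    acts as v on the module of functions on the infinite paths ending in
    c c c ... (a Chen module). Its annihilator contains v - c but not v, and is
    not graded.

    Conversely, let I be an ideal, and let a sum of homogeneous y_i lie in I
    with some y_i outside I. By (CK2) one can multiply on the right by a path
    that is long (or ends in a sink) and keep y_i outside I; all terms are then
    combinations of real paths into one vertex w. Among the terms outside I pick
    the one of least degree d and multiply on the left by alpha^* for a suitable
    path alpha of length d: it becomes a scalar multiple of w, and so I contains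
    w + x, where w is not in I and x is a combination of closed paths of positive
    length at w.
    If there is no closed path at w then x = 0. Otherwise take closed simple
    paths c1 <> c2 at w and put q = c1^m c2; for large m, q^* x q = 0 while
    q^* w q = w, whence w is in I, a contradiction. *)

Require Import Defs.
From mathcomp Require Import all_boot all_algebra.
From mathcomp Require Import boolp classical_sets.
From mathcomp Require Import zify.

Set Implicit Arguments.
Unset Strict Implicit.
Unset Printing Implicit Defensive.

Import GRing.Theory Num.Theory.
Local Open Scope ring_scope.
Local Open Scope quotient_scope.

(** * Walks as edge lists, and first returns to a vertex *)

Section Walks.
Variable E : digraph.
Implicit Types (u v w : vertex E) (e f : edge E) (s t : seq (edge E)).

Fixpoint walk u s w : bool :=
  if s is e :: s' then (esource e == u) && walk (erange e) s' w else u == w.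

(** Only sources are tested, so a walk that avoids [w] may still end at [w]. *)
Definition avoids w s : bool := all (fun f => esource f != w) s.

Definition cswalk w s : bool :=
  [&& walk w s w, s != [::] & avoids w (behead s)].

Definition pedges (a : gpath E) : seq (edge E) :=
  if a is PEdges e p then e :: p else [::].

Lemma size_pedges a : size (pedges a) = pdeg a.
Proof. by case: a. Qed.

Lemma walk_pathE u e s w :
  walk u (e :: s) w =
    [&& esource e == u, path (fun e f => erange e == esource f) e s &
        erange (last e s) == w].
Proof.
elim: s u e => [|f s IH] u e //=; congr (_ && _).
by have /= -> := IH (erange e) f; rewrite [esource f == _]eq_sym -andbA.
Qed.

Lemma is_path_walk a : is_path a = walk (psource a) (pedges a) (prange a).
Proof.
by case: a => [v|e p]; rewrite /pedges ?walk_pathE /= ?eqxx ?andbT.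
Qed.

Lemma walk_is_path u s w : walk u s w ->
  exists a, [/\ is_path a, pedges a = s, psource a = u & prange a = w].
Proof.
case: s => [/eqP ->|e s]; first by exists (PVertex w).
by rewrite walk_pathE => /and3P[/eqP <- p /eqP <-]; exists (PEdges e s).
Qed.

Lemma walk_cat u v w s t : walk u s v -> walk v t w -> walk u (s ++ t) w.
Proof.
elim: s u => [|e s IH] u /=; first by move=> /eqP ->.
by move=> /andP[-> /= ws] wt; apply: IH.
Qed.

Lemma closed_simple_pathE v a :
  closed_simple_path v a = cswalk v (pedges a) && (psource a == v).
Proof.
case: a => [u|e p]; first by rewrite /closed_simple_path /cswalk /= !andbF.
rewrite /closed_simple_path /closed_path /cswalk /pedges walk_pathE /=.
by have [->|] := eqVneq (esource e) v; rewrite ?andbT ?andbF // [v == _]eq_sym.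
Qed.

Lemma cswalk_path v s : cswalk v s ->
  exists2 a, closed_simple_path v a & pedges a = s.
Proof.
move=> cs; case/and3P: (cs) => /walk_is_path [a [pa sa ua _]] _ _.
by exists a => //; rewrite closed_simple_pathE sa cs ua eqxx.
Qed.

(** [pedges] sends every [PVertex] to the empty list, but a closed simple path has at least one
    edge. *)
Lemma pedges_inj v a b : closed_simple_path v a -> closed_simple_path v b ->
  pedges a = pedges b -> a = b.
Proof.
rewrite !closed_simple_pathE => /andP[/and3P[_ na _] _] /andP[/and3P[_ nb _] _].
by case: a b na nb => [u|e p] [u'|e' p'] //= _ _ [-> ->].
Qed.

Lemma condition_KP : condition_K E <->
  forall v, (forall s, ~~ cswalk v s) \/
    exists s t, [/\ s <> t, cswalk v s & cswalk v t].
Proof.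
split=> K v.
  case: (K v) => [no|[a [b [ab ca cb]]]].
    by left=> s; apply/negP => /cswalk_path[a /no].
  right; exists (pedges a), (pedges b); split.
  - by move=> /(pedges_inj ca cb).
  - by move: ca; rewrite closed_simple_pathE => /andP[].
  - by move: cb; rewrite closed_simple_pathE => /andP[].
case: (K v) => [no|[s [t [st /cswalk_path[a ca sa] /cswalk_path[b cb tb]]]]].
  by left=> a; rewrite closed_simple_pathE => /andP[]; rewrite (negPf (no _)).
right; exists a, b; split=> // ab; apply: st.
by rewrite -sa -tb ab.
Qed.

Lemma walk_first_return u s w : walk u s w -> u != w ->
  exists d t, [/\ s = d ++ t, walk u d w, walk w t w & avoids w d].
Proof.
elim: s u => [|e s IH] u /=; first by move=> /eqP -> /eqP.
move=> /andP[/eqP eu ws] uw.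
have [rw|rw] := eqVneq (erange e) w.
  exists [:: e], s; split=> //=; last by rewrite eu uw.
  - by rewrite eu rw !eqxx.
  - by rewrite -{1}rw.
have [d [t [-> wd wt ad]]] := IH _ ws rw.
by exists (e :: d), t; split=> //=; rewrite ?eu ?eqxx // uw.
Qed.

Lemma closed_walk_first_return w s : walk w s w -> s != [::] ->
  exists d t, [/\ s = d ++ t, cswalk w d & walk w t w].
Proof.
case: s => [|e s] //= /andP[/eqP ew ws] _.
have [rw|rw] := eqVneq (erange e) w.
  exists [:: e], s; split=> //=; last by rewrite -{1}rw.
  by rewrite /cswalk /= ew rw !eqxx.
have [d [t [-> wd wt ad]]] := walk_first_return ws rw.
by exists (e :: d), t; split=> //; rewrite /cswalk /= ew eqxx wd.
Qed.

End Walks.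

(** * Real and ghost paths in the algebra, and linear spans *)

Section Elements.
Variables (K : fieldType) (E : digraph).
Local Notation L := (LPA K E).
Local Notation lv := (@lpa_vertex K E).
Local Notation le := (@lpa_edge K E).
Local Notation lg := (@lpa_ghost K E).
Implicit Types (u v w : vertex E) (e f : edge E) (s t : seq (edge E)).
Implicit Types (x y z : L).

Lemma lpa_vertexM u v : lv u * lv v = if u == v then lv u else 0.
Proof.
rewrite -lpa_piM; case: eqP => [<-|uv]; apply/lpa_piP; first exact: LV_eq.
exact: LV_neq.
Qed.

Lemma lpa_vertexK v : lv v * lv v = lv v.
Proof. by rewrite lpa_vertexM eqxx. Qed.

Lemma lpa_edge_range e : le e * lv (erange e) = le e.
Proof. by rewrite -lpa_piM; apply/lpa_piP; apply: LE1_range. Qed.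

Lemma lpa_edge_source e : lv (esource e) * le e = le e.
Proof. by rewrite -lpa_piM; apply/lpa_piP; apply: LE1_source. Qed.

Lemma lpa_ghost_source e : lg e * lv (esource e) = lg e.
Proof. by rewrite -lpa_piM; apply/lpa_piP; apply: LE2_source. Qed.

Lemma lpa_ghost_range e : lv (erange e) * lg e = lg e.
Proof. by rewrite -lpa_piM; apply/lpa_piP; apply: LE2_range. Qed.

Lemma lpa_ghost_edge e f : lg e * le f = if e == f then lv (erange e) else 0.
Proof.
rewrite -lpa_piM; case: eqP => [<-|ef]; apply/lpa_piP; first exact: LCK1_eq.
exact: LCK1_neq.
Qed.

Lemma lpa_CK2 e0 : lv (esource e0) =
  \sum_(e : edge E | esource e == esource e0) le e * lg e.
Proof.
have /lpa_piP := @LCK2 K E (esource e0) (ex_intro _ e0 erefl).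
rewrite -[LHS]/(lv _) => ->.
rewrite (big_morph _ (@lpa_piD K E) (@lpa_pi0 K E)).
by apply: eq_bigr => e _; rewrite lpa_piM.
Qed.

(* The factor [lv v] gives the empty walk its base point, so that these are the
   elements alpha and alpha^* for a path alpha with source v. Both are locked:
   otherwise patterns such as [lv w * _] match inside them by unfolding. *)
Definition real v s : L := locked (lv v * \prod_(f <- s) le f).
Definition ghost v s : L := locked ((\prod_(f <- rev s) lg f) * lv v).

Lemma real_nil v : real v [::] = lv v.
Proof. by rewrite /real -!lock big_nil mulr1. Qed.

Lemma ghost_nil v : ghost v [::] = lv v.
Proof. by rewrite /ghost -lock big_nil mul1r. Qed.

Lemma real_cons v e s :
  esource e = v -> real v (e :: s) = le e * real (erange e) s.
Proof.
move=> <-; rewrite /real -!lock big_cons !mulrA.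
by rewrite lpa_edge_source lpa_edge_range.
Qed.

Lemma ghost_cons v e s :
  esource e = v -> ghost v (e :: s) = ghost (erange e) s * lg e.
Proof.
move=> <-; rewrite /ghost -!lock rev_cons -cats1 big_cat big_seq1 /=.
by rewrite -!mulrA lpa_ghost_source lpa_ghost_range.
Qed.

Lemma lpa_vertex_real u v s : lv u * real v s = if u == v then real v s else 0.
Proof.
by rewrite /real -!lock mulrA lpa_vertexM; case: eqP => [->|]; rewrite ?mul0r.
Qed.

Lemma ghost_vertex v s : ghost v s * lv v = ghost v s.
Proof. by rewrite /ghost -lock -mulrA lpa_vertexK. Qed.

Lemma real_vertex u s w : walk u s w -> real u s * lv w = real u s.
Proof.
elim: s u => [|e s IH] u /=.
  by move=> /eqP ->; rewrite real_nil lpa_vertexK.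
by move=> /andP[/eqP eu ws]; rewrite real_cons // -mulrA IH.
Qed.

Lemma real_cat u s v t : walk u s v -> real u (s ++ t) = real u s * real v t.
Proof.
elim: s u => [|e s IH] u /=.
  by move=> /eqP ->; rewrite real_nil lpa_vertex_real eqxx.
by move=> /andP[/eqP eu ws]; rewrite !real_cons // -mulrA IH.
Qed.

Lemma path_eltE a : is_path a -> path_elt K a = real (psource a) (pedges a).
Proof.
case: a => [v|e p] _ /=; first by rewrite real_nil.
by rewrite /real -!lock big_cons mulrA lpa_edge_source.
Qed.

Lemma path_starE a : is_path a -> path_star K a = ghost (psource a) (pedges a).
Proof.
case: a => [v|e p] _ /=; first by rewrite ghost_nil.
rewrite /ghost -!lock rev_cons -cats1 big_cat big_seq1 /= -mulrA.
by rewrite lpa_ghost_source.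
Qed.

Lemma ghost_real_cons v e f s t : esource e = v -> esource f = v ->
  ghost v (e :: s) * real v (f :: t) =
    if e == f then ghost (erange e) s * real (erange e) t else 0.
Proof.
move=> ev fv; rewrite ghost_cons // real_cons // -mulrA [lg e * _]mulrA.
rewrite lpa_ghost_edge; case: eqP => [<-|_]; last by rewrite mul0r mulr0.
by rewrite lpa_vertex_real eqxx.
Qed.

Lemma ghost_real_neq u v s t : u != v -> ghost u s * real v t = 0.
Proof.
move=> uv; rewrite /ghost /real -!lock -mulrA [lv u * _]mulrA.
rewrite lpa_vertexM (negPf uv).
by rewrite mul0r mulr0.
Qed.

Lemma ghostK u s w : walk u s w -> ghost u s * real u s = lv w.
Proof.
elim: s u => [|e s IH] u /=.
  by move=> /eqP ->; rewrite ghost_nil real_nil lpa_vertexK.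
by move=> /andP[/eqP eu ws]; rewrite ghost_real_cons // eqxx IH.
Qed.

Definition sink w := forall e, esource e <> w.

(** If [t] were a proper prefix of [s], it would be shorter and an edge of [s] would leave [w];
    either assumption excludes this. So [s] is a prefix of [t], or (CK1) kills the product. *)
Lemma ghost_real u s v w t : walk u s v -> walk u t w ->
  (size s <= size t)%N \/ sink w ->
  ghost u s * real u t = 0 \/
  exists t', [/\ t = s ++ t', walk v t' w & ghost u s * real u t = real v t'].
Proof.
elim: s u t => [|e s IH] u t.
  move=> /eqP <- wt _; right; exists t; split=> //.
  by rewrite ghost_nil lpa_vertex_real eqxx.
move=> /= /andP[/eqP eu ws]; case: t => [|f t] /=.
  by move=> /eqP uw [//|] /(_ e); rewrite eu.
move=> /andP[/eqP fu wt] st; rewrite ghost_real_cons //.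
case: eqP => [ef|_]; last by left.
rewrite -ef in wt.
have {}st : (size s <= size t)%N \/ sink w by case: st; [left|right].
case: (IH _ _ ws wt st) => [->|[t' [-> wt' ->]]]; [by left|right].
by exists t'; rewrite -ef.
Qed.

(** Neither walk is a proper prefix of the other, as the longer one would leave [w]; hence they
    differ at some edge and (CK1) gives zero. *)
Lemma ghost_real_avoids u s t w : walk u s w -> walk u t w ->
  avoids w s -> avoids w t -> s <> t -> ghost u s * real u t = 0.
Proof.
elim: s u t => [|e s IH] u [|f t] //=.
- by move=> /eqP -> /andP[-> ].
- by move=> /andP[/eqP -> _] /eqP ->; rewrite eqxx.
move=> /andP[/eqP eu ws] /andP[/eqP fu wt] /andP[_ as_] /andP[_ at_] st.
rewrite ghost_real_cons //; case: eqP => // ef; rewrite -ef in wt st.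
by apply: IH => // s_t; apply: st; rewrite s_t.
Qed.

Lemma ghost_real_cswalk w s t : cswalk w s -> cswalk w t -> s <> t ->
  ghost w s * real w t = 0.
Proof.
case: s t => [|e s] [|f t]; rewrite /cswalk ?andbF //=.
move=> /andP[/andP[/eqP ew ws] as_] /andP[/andP[/eqP fw wt] at_] st.
rewrite ghost_real_cons //; case: eqP => // ef; rewrite -ef in wt st.
by apply: (ghost_real_avoids ws) => // s_t; apply: st; rewrite s_t.
Qed.

Inductive span (P : L -> Prop) : L -> Prop :=
  | Span0 : span P 0
  | SpanD k x y : P x -> span P y -> span P (k *: x + y).

Lemma span_add P x y : span P x -> span P y -> span P (x + y).
Proof.
move=> Sx Sy; elim: Sx => [|k a b Pa _ IH]; first by rewrite add0r.
by rewrite -addrA; apply: SpanD.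
Qed.

Lemma span_sum P (J : Type) (r : seq J) (Q : pred J) F :
  (forall j, Q j -> span P (F j)) -> span P (\sum_(j <- r | Q j) F j).
Proof. by move=> SF; apply: big_ind => //; [apply: Span0|apply: span_add]. Qed.

Lemma span_scale P k x : span P x -> span P (k *: x).
Proof.
elim=> [|k' a b Pa _ IH]; first by rewrite scaler0; apply: Span0.
by rewrite scalerDr scalerA; apply: SpanD.
Qed.

(* The value [0] is allowed since products of monomials may vanish. *)
Lemma span_mull (P Q : L -> Prop) a :
  (forall x, P x -> a * x = 0 \/ Q (a * x)) ->
  forall x, span P x -> span Q (a * x).
Proof.
move=> aPQ x; elim=> [|k y z /aPQ Py _ IH]; first by rewrite mulr0; apply: Span0.
rewrite mulrDr -scale_lpaAr; case: Py => [->|Qy]; last exact: SpanD.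
by rewrite scaler0 add0r.
Qed.

Lemma span_eq0 (P : L -> Prop) x :
  (forall y, P y -> y = 0) -> span P x -> x = 0.
Proof.
by move=> P0; elim=> // k y z /P0 -> _ ->; rewrite scaler0 addr0.
Qed.

End Elements.

(** * Condition (K) makes every ideal graded *)

Section IdealsAreGraded.
Variables (K : fieldType) (E : digraph).
Local Notation L := (LPA K E).
Local Notation lv := (@lpa_vertex K E).
Local Notation le := (@lpa_edge K E).
Local Notation lg := (@lpa_ghost K E).
Local Notation real := (@real K E).
Local Notation ghost := (@ghost K E).
Implicit Types (u v w : vertex E) (e f : edge E) (s t : seq (edge E)).
Implicit Types (x y z : L).

Definition monomial (i : int) x := exists u v w s t,
  [/\ walk u s w, walk v t w, (size s)%:Z - (size t)%:Z = i &
      x = real u s * ghost v t].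

(** The degree [n] is an integer because homogeneous degrees may be negative; no real path qualifies
    then. *)
Definition real_monomial (n : int) w x := exists u s,
  [/\ walk u s w, (size s)%:Z = n & x = real u s].

Definition closed_monomial w x := exists s,
  [/\ walk w s w, s != [::] & x = real w s].

Lemma component_span i x : component i x -> span (monomial i) x.
Proof.
move=> [n [k [a [b [ab ->]]]]]; apply: big_ind; first exact: Span0.
  exact: span_add.
move=> j _; rewrite -[_ *: _]addr0; apply: SpanD; last exact: Span0.
have [pa pb rab dab] := ab j.
exists (psource (a j)), (psource (b j)), (prange (a j)).
exists (pedges (a j)), (pedges (b j)).
rewrite !size_pedges path_eltE // path_starE //.
by split=> //; [rewrite -is_path_walk | rewrite rab -is_path_walk].
Qed.

(** [N] bounds the lengths of the finitely many ghost paths in [x]; a path of length at least [N],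
    or one ending in a sink, absorbs each of them or kills the term. *)
Lemma span_monomial_real i x : span (monomial i) x -> exists N, forall v t w,
  walk v t w -> (N <= size t)%N \/ sink w ->
  span (real_monomial (i + (size t)%:Z) w) (x * real v t).
Proof.
elim=> [|k {}x y [u [v' [r [s [b [us vb ib ->]]]]]] _ [N HN]].
  by exists 0%N => v t w _ _; rewrite mul0r; apply: Span0.
exists (maxn N (size b)) => v t w vt Nt.
rewrite mulrDl -scale_lpaAl -mulrA.
have {HN} Sy : span (real_monomial (i + (size t)%:Z) w) (y * real v t).
  by apply: HN => //; case: Nt => [|?]; [rewrite geq_max => /andP[]; left|right].
have [v'v|v'v] := eqVneq v' v; last first.
  by rewrite ghost_real_neq // mulr0 scaler0 add0r.
have {}Nt : (size b <= size t)%N \/ sink w.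
  by case: Nt => [|?]; [rewrite geq_max => /andP[]; left|right].
rewrite v'v in vb *.
have [->|[t' [def_t rt' ->]]] := ghost_real K vb vt Nt.
  by rewrite mulr0 scaler0 add0r.
apply: SpanD => //; exists u, (s ++ t'); split; first exact: walk_cat us rt'.
  by rewrite -ib def_t !size_cat; lia.
by rewrite -(real_cat _ _ us).
Qed.

Lemma ghost_real_monomial n w x u s v : walk u s v -> (size s)%:Z <= n ->
  real_monomial n w x ->
  ghost u s * x = 0 \/ real_monomial (n - (size s)%:Z) w (ghost u s * x).
Proof.
move=> us sn [u' [t [u't tn ->]]].
have [uu'|uu'] := eqVneq u u'; last by left; rewrite ghost_real_neq.
rewrite -uu' in u't *.
have st : (size s <= size t)%N by rewrite -lez_nat tn.
have [->|[t' [def_t vt' ->]]] := ghost_real K us u't (or_introl st).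
  by left.
right; exists v, t'; split=> //.
by rewrite -tn def_t size_cat; lia.
Qed.

Lemma real_monomial0 w x :
  span (real_monomial 0 w) x -> exists k, x = k *: lv w.
Proof.
elim=> [|k y z [u [s [us s0 ->]]] _ [k' ->]].
  by exists 0; rewrite scale0r.
case: s us s0 => // /eqP -> _; exists (k + k').
by rewrite real_nil scalerDl.
Qed.

(** * Conjugation by c1^m c2 for two closed simple paths *)

Section TwoReturns.
Variables (w : vertex E) (c1 c2 : seq (edge E)).
Hypotheses (cs1 : cswalk w c1) (cs2 : cswalk w c2) (c12 : c1 <> c2).

Let w1 : walk w c1 w. Proof. by case/and3P: cs1. Qed.
Let w2 : walk w c2 w. Proof. by case/and3P: cs2. Qed.

(** The factor [lv w] stays explicit because a zeroth power is the unit of the algebra, not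
    [lv w]. *)
Lemma ghost_real_exp m n : (m <= n)%N ->
  ghost w c1 ^+ m * lv w * real w c1 ^+ n = lv w * real w c1 ^+ (n - m).
Proof.
elim: m n => [|m IH] [|n] // mn; rewrite ?subn0 ?expr0 ?mul1r //.
rewrite subSS -IH // exprSr exprS -!mulrA [lv w * (_ * _)]mulrA.
rewrite lpa_vertex_real eqxx.
by rewrite [ghost w c1 * (_ * _)]mulrA (ghostK _ w1).
Qed.

(** A surplus factor c1 meets c2^*, and c2^* c1 = 0 for distinct closed simple paths. *)
Lemma conj_vertex_lt m n : (m < n)%N ->
  ghost w c2 * ghost w c1 ^+ m * lv w * (real w c1 ^+ n * real w c2) = 0.
Proof.
move=> mn; rewrite -!mulrA [lv w * (_ * _)]mulrA.
rewrite [ghost w c1 ^+ _ * _]mulrA [ghost w c1 ^+ _ * (_ * _)]mulrA.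
rewrite ghost_real_exp ?(ltnW mn) // !mulrA ghost_vertex.
case: (n - m)%N (subn_gt0 m n) => [|k _]; first by rewrite mn.
by rewrite exprS !mulrA ghost_real_cswalk ?mul0r // => /esym.
Qed.

(* [c1^m c2] is not a prefix of [s c1^n c2]: each first return of [s] to [w]
   either cancels against one factor of [c1^m] or kills the product. *)
Lemma conj_closed_walk m n s : walk w s w -> (size s <= m)%N ->
  (m < n + (s != [::]))%N ->
  ghost w c2 * ghost w c1 ^+ m * real w s * (real w c1 ^+ n * real w c2) = 0.
Proof.
elim: m n s => [|m IH] n s ws sm mn; have [s0|sN] := eqVneq s [::].
- by rewrite s0 real_nil conj_vertex_lt //; move: mn; rewrite s0 addn0.
- by case: s sm sN {ws mn}.
- by rewrite s0 real_nil conj_vertex_lt //; move: mn; rewrite s0 addn0.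
have [d [t [def_s csd wt]]] := closed_walk_first_return ws sN.
have wd : walk w d w by case/and3P: csd.
rewrite def_s (real_cat _ _ wd) exprSr -!mulrA [ghost w c1 * (_ * _)]mulrA.
have [dc|dc] := pselect (c1 = d); last first.
  by rewrite ghost_real_cswalk // mul0r !mulr0.
have dN : (0 < size d)%N by case/and3P: csd; case: (d).
rewrite -dc (ghostK _ w1) [lv w * (_ * _)]mulrA lpa_vertex_real eqxx.
rewrite !mulrA -[_ * real w c2]mulrA.
apply: IH => //; first by move: sm; rewrite def_s size_cat; lia.
(* Cancelling one factor turns [m.+1 < n + 1] into [m < n], so the bound survives even when [t] is
   empty. *)
by move: mn; rewrite sN; case: (t != [::]); lia.
Qed.

Lemma conj_closed_span x : span (closed_monomial w) x -> exists M, forall m,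
  (M <= m)%N ->
  ghost w c2 * ghost w c1 ^+ m * x * (real w c1 ^+ m * real w c2) = 0.
Proof.
elim=> [|k y z [s [ws sN ->]] _ [M HM]].
  by exists 0%N => m _; rewrite mulr0 mul0r.
exists (maxn M (size s)) => m; rewrite geq_max => /andP[Mm sm].
rewrite mulrDr mulrDl HM // -scale_lpaAr -scale_lpaAl conj_closed_walk //.
  by rewrite scaler0 addr0.
by rewrite sN addn1.
Qed.

Lemma conj_vertex m :
  ghost w c2 * ghost w c1 ^+ m * lv w * (real w c1 ^+ m * real w c2) = lv w.
Proof.
rewrite -!mulrA [lv w * (_ * _)]mulrA [ghost w c1 ^+ _ * _]mulrA.
rewrite [ghost w c1 ^+ _ * (_ * _)]mulrA ghost_real_exp // subnn expr0 mulr1.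
by rewrite lpa_vertex_real eqxx (ghostK _ w2).
Qed.

End TwoReturns.

(** * Multiplications that keep an element outside an ideal *)

Variable I : set L.
Hypothesis idI : ideal I.

Lemma ideal0 : I 0. Proof. by case: idI. Qed.

Lemma idealB x y : I x -> I y -> I (x - y).
Proof. by case: idI => _ IB _ _; apply: IB. Qed.

Lemma idealMl a x : I x -> I (a * x).
Proof. by case: idI => _ _ IM _; apply: IM. Qed.

Lemma idealMr a x : I x -> I (x * a).
Proof. by case: idI => _ _ _ IM; apply: IM. Qed.

Lemma idealD x y : I x -> I y -> I (x + y).
Proof.
move=> Ix Iy; rewrite -[y]opprK -[- y]add0r.
by do 2![apply: idealB => //]; apply: ideal0.
Qed.

Lemma idealZ k x : I x -> I (k *: x).
Proof. by move=> Ix; rewrite -[x]mul1r scale_lpaAl; apply: idealMl. Qed.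

Lemma ideal_sum (J : Type) (r : seq J) (P : pred J) F :
  (forall j, P j -> I (F j)) -> I (\sum_(j <- r | P j) F j).
Proof. by move=> IF; apply: big_ind => //; [apply: ideal0|apply: idealD]. Qed.

Lemma not_sink v : ~ sink v -> exists e, esource e = v.
Proof.
by move=> nv; apply: contrapT => ne; apply: nv => e ev; apply: ne; exists e.
Qed.

Lemma mulr_vertex_notin x : ~ I x -> exists v, ~ I (x * lv v).
Proof.
move=> nx; apply: contrapT => nv; apply: nx.
rewrite -[x]mulr1 lpa_oneE mulr_sumr; apply: ideal_sum => v _.
by apply: contrapT => xv; apply: nv; exists v.
Qed.

Lemma mull_vertex_notin x : ~ I x -> exists v, ~ I (lv v * x).
Proof.
move=> nx; apply: contrapT => nv; apply: nx.
rewrite -[x]mul1r lpa_oneE mulr_suml; apply: ideal_sum => v _.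
by apply: contrapT => xv; apply: nv; exists v.
Qed.

(** By (CK2), x v is the sum of (x e) e^* over the edges e leaving v, so some x e stays outside [I].
    This is repeated until length [n] or a sink is reached. *)
Lemma mulr_real_notin n x v : ~ I (x * lv v) ->
  exists t w, [/\ walk v t w, ~ I (x * real v t) & size t = n \/ sink w].
Proof.
elim: n x v => [|n IH] x v nx.
  by exists [::], v; rewrite real_nil /= eqxx; split=> //; left.
have [sv|/not_sink[e0 e0v]] := pselect (sink v).
  by exists [::], v; rewrite real_nil /= eqxx; split=> //; right.
have [e [ev ne]] : exists e, esource e = v /\ ~ I (x * le e).
  apply: contrapT => no; apply: nx; rewrite -e0v lpa_CK2 mulr_sumr e0v.
  apply: ideal_sum => e /eqP ev; rewrite mulrA; apply: idealMr.
  by apply: contrapT => ne; apply: no; exists e.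
have [|t [w [et nt tw]]] := IH (x * le e) (erange e).
  by rewrite -mulrA lpa_edge_range.
exists (e :: t), w; rewrite real_cons // mulrA /= ev eqxx; split=> //.
by case: tw => [<-|]; [left|right].
Qed.

(** (CK2) is now used on the left. No sink stops the process early: while the degree is positive,
    every path in [x] has a first edge, so [lv u * x] would vanish at a sink [u]. *)
Lemma mull_ghost_notin n x u w : span (real_monomial n%:Z w) x ->
  ~ I (lv u * x) ->
  exists s v, [/\ walk u s v, size s = n & ~ I (ghost u s * x)].
Proof.
elim: n x u => [|n IH] x u Sx nx.
  by exists [::], u; rewrite ghost_nil /= eqxx.
have [su|/not_sink[e0 e0u]] := pselect (sink u).
  case: nx; have -> : lv u * x = 0; last exact: ideal0.
  apply: (@span_eq0 _ _ (fun=> False)) => //; move: x Sx; apply: span_mull.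
  move=> y [v [[|e s] [vs // _ ->]]]; left; rewrite lpa_vertex_real.
  by case: eqP => // uv; case/andP: vs => /eqP; rewrite -uv => /su.
have [e [eu ne]] : exists e, esource e = u /\ ~ I (lg e * x).
  apply: contrapT => no; apply: nx; rewrite -e0u lpa_CK2 mulr_suml e0u.
  apply: ideal_sum => e /eqP eu; rewrite -mulrA; apply: idealMl.
  by apply: contrapT => ne; apply: no; exists e.
have gE : lg e = ghost u [:: e].
  by rewrite ghost_cons // ghost_nil lpa_ghost_range.
have we : walk u [:: e] (erange e) by rewrite /= eu !eqxx.
have [||s [v [es sn ns]]] := IH (lg e * x) (erange e).
- move: x Sx {nx ne}; apply: span_mull => y My; rewrite gE.
  have -> : n%:Z = n.+1%:Z - (size [:: e])%:Z by rewrite /=; lia.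
  by apply: (ghost_real_monomial we).
- by rewrite mulrA lpa_ghost_range.
exists (e :: s), v; rewrite ghost_cons // -mulrA /= eu eqxx sn; split=> //.
Qed.

Lemma vertex_in_ideal w x : condition_K E -> span (closed_monomial w) x ->
  I (lv w + x) -> I (lv w).
Proof.
move=> /condition_KP/(_ w)[no|[c1 [c2 [c12 cs1 cs2]]]] Sx Iwx.
  rewrite -[lv w]addr0 -(span_eq0 _ Sx) // => y [s [ws sN _]].
  have [d [t [_ csd _]]] := closed_walk_first_return ws sN.
  by rewrite (negPf (no d)) in csd.
have [M HM] := conj_closed_span cs1 cs2 c12 Sx.
have := idealMr (real w c1 ^+ M * real w c2)
  (idealMl (ghost w c2 * ghost w c1 ^+ M) Iwx).
by rewrite mulrDr mulrDl HM // conj_vertex // addr0.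
Qed.

Lemma condition_K_graded : condition_K E -> graded I.
Proof.
move=> condK r y Ur Cy Iy i0 ri0; apply: contrapT => ny.
have [N0 HN0] := choice (fun i => span_monomial_real (component_span (Cy i))).
pose N := \max_(i <- r) N0 i.
have [v nyv] := mulr_vertex_notin ny.
have [t [w [vt nyt tw]]] := mulr_real_notin N nyv.
pose z i := y i * real v t.
have Sz i : i \in r -> span (real_monomial (i + (size t)%:Z) w) (z i).
  move=> ri; apply: HN0 => //; case: tw => [->|]; [left|by right].
  exact: leq_bigmax_seq.
have Iz : I (\sum_(i <- r) z i) by rewrite -mulr_suml; apply: idealMr.
(* In negative degree there are no real paths, so [z i] would be 0. *)
have degz i : i \in r -> ~ I (z i) -> exists n, i + (size t)%:Z = n%:Z.
  move=> ri nz; apply: contrapT => no; apply: nz.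
  rewrite (span_eq0 _ (Sz i ri)); first exact: ideal0.
  by move=> x [u [s [_ sn _]]]; case: no; exists (size s).
pose P n := has (fun i => (i + (size t)%:Z == n%:Z) && `[< ~ I (z i) >]) r.
have exP : exists n, P n.
  have [n i0n] := degz _ ri0 nyt.
  by exists n; apply/hasP; exists i0; rewrite // i0n eqxx; apply/asboolP.
case: (ex_minnP exP) => d /hasP[i1 ri1 /andP[/eqP i1d /asboolP nz1]] mind.
have [u nuz] := mull_vertex_notin nz1.
have Sz1 := Sz _ ri1; rewrite i1d in Sz1.
have [s [u' [us sd nsz]]] := mull_ghost_notin Sz1 nuz.
(* By minimality of [d], the ghost path of length [d] is no longer than the paths in any [z i]
   outside [I], so only real paths remain. *)
have Saz i : i \in r -> ~ I (z i) ->
    0 <= i - i1 /\ span (real_monomial (i - i1) w) (ghost u s * z i).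
  move=> ri nz; have [n ni] := degz _ ri nz.
  have dn : (d <= n)%N.
    by apply: mind; apply/hasP; exists i; rewrite // ni eqxx; apply/asboolP.
  split; first by lia.
  have -> : i - i1 = n%:Z - (size s)%:Z by lia.
  move: (Sz i ri); rewrite ni; apply: span_mull => x.
  by apply: (ghost_real_monomial us); rewrite sd lez_nat.
have [k zk] : exists k, ghost u s * z i1 = k *: lv w.
  by apply: real_monomial0; have [_] := Saz _ ri1 nz1; rewrite subrr.
have kN : k != 0.
  by apply/eqP => k0; apply: nsz; rewrite zk k0 scale0r; apply: ideal0.
have nw : ~ I (lv w) by move=> Iw; apply: nsz; rewrite zk; apply: idealZ.
pose bad := [pred i | `[< ~ I (z i) >]].
(* The terms already in [I] are discarded, since minimality of [d] says nothing about their
   degrees. *)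
have Ibad : I (\sum_(i <- r | bad i) z i).
  rewrite (bigID bad) /= in Iz.
  rewrite -[X in I X](addrK (\sum_(i <- r | ~~ bad i) z i)).
  apply: idealB => //; apply: ideal_sum => i.
  by rewrite /= => /asboolPn/contrapT.
apply: nw; apply: (@vertex_in_ideal w
  (k^-1 *: \sum_(i <- r | bad i && (i != i1)) lv w * (ghost u s * z i))) => //.
  apply: span_scale; rewrite big_seq_cond.
  apply: span_sum => i /andP[ri /andP[/asboolP nz i1i]].
  have [ge0 Si] := Saz i ri nz.
  move: (ghost u s * z i) Si; apply: span_mull => _ [v' [p [wp pn ->]]].
  (* The left factor [lv w] keeps only walks from [w] to [w]; their length [i - i1] is nonzero
     because [i != i1]. *)
  rewrite lpa_vertex_real; case: eqP => [wv'|]; [right|by left].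
  rewrite -wv' in wp *; exists p; split=> //.
  by apply: contra_neq i1i => p0; move: pn; rewrite p0 /=; lia.
have := idealZ k^-1 (idealMl (lv w) (idealMl (ghost u s) Ibad)).
rewrite -big_filter (bigD1_seq i1) ?filter_uniq ?mem_filter ?ri1 ?andbT //=;
  last exact/asboolP.
rewrite big_filter_cond.
rewrite !mulrDr scalerDr zk -scale_lpaAr lpa_vertexK scalerA mulVf // scale1r.
by rewrite !mulr_sumr.
Qed.

End IdealsAreGraded.

(** * The Chen module and its non-graded annihilator *)

(* When [c] is the only closed simple path at [v], the infinite paths ending in
   [c c c ...] are determined by their initial segment up to the first visit to
   [v]: the first-passage walk [s] stands for the infinite path [s c c c ...]. *)
Section ChenModule.
Variables (K : fieldType) (E : digraph) (v : vertex E) (c : seq (edge E)).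
Hypothesis csc : cswalk v c.
Hypothesis c_unique : forall d, cswalk v d -> d = c.
Local Notation L := (LPA K E).
Local Notation lv := (@lpa_vertex K E).
Local Notation le := (@lpa_edge K E).
Local Notation F := (seq (edge E) -> K).
Implicit Types (u w : vertex E) (e f : edge E) (s t : seq (edge E)) (xi : F).

Definition source s : vertex E := if s is e :: _ then esource e else v.

Definition first_passage s : bool := walk (source s) s v && avoids v s.

(** The list [[::]] stands for c c c ..., so one copy of [c] is exposed to read off the first
    edge. *)
Definition unroll s : seq (edge E) := if s is [::] then c else s.

Definition prepend e s : seq (edge E) :=
  if esource e == v then [::] else e :: s.

Lemma first_passage_walk u s : walk u s v -> avoids v s ->
  first_passage s /\ source s = u.
Proof.
rewrite /first_passage => ws av.
have <- : source s = u by case: s ws {av} => [/eqP|e s /andP[/eqP]].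
split; last by [].
by rewrite av andbT; case: s ws {av} => //= e s /andP[_ ->]; rewrite eqxx.
Qed.

Lemma walk_first_passage s :
  first_passage s -> walk (source s) s v /\ avoids v s.
Proof. by case/andP. Qed.

Lemma unrollP s : first_passage s -> exists e t,
  [/\ unroll s = e :: t, first_passage t, source t = erange e, prepend e t = s
    & esource e = source s].
Proof.
case: s => [_|e s] /=.
  case: c csc => [|e t]; first by rewrite /cswalk andbF.
  case/and3P=> /andP[/eqP ev wt] _ /= at_.
  have [ft st] := first_passage_walk wt at_.
  by exists e, t; split=> //; rewrite /prepend ev eqxx.
move=> /walk_first_passage[/= /andP[_ ws] /andP[ev as_]].
have [fs ss] := first_passage_walk ws as_.
by exists e, s; split=> //; rewrite /prepend (negPf ev).
Qed.

(** If [e] leaves [v], then [e :: s] is a closed simple path, hence equal to [c] by uniqueness, and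
    the extended infinite path is again c c c ..., stored as [[::]]. *)
Lemma prependP e s : first_passage s -> source s = erange e ->
  [/\ first_passage (prepend e s), source (prepend e s) = esource e
    & unroll (prepend e s) = e :: s].
Proof.
move=> /walk_first_passage[ws as_] se; rewrite se in ws.
rewrite /prepend; case: eqP => [ev|/eqP ev].
  have -> : e :: s = c by apply: c_unique; rewrite /cswalk /= ev eqxx ws.
  by rewrite /first_passage /= eqxx.
have [||-> ->] := @first_passage_walk (esource e) (e :: s) => //=.
- by rewrite eqxx.
- by rewrite ev.
Qed.

(** A function is read as a possibly infinite formal combination of infinite paths: an edge [e]
    moves the value at p to e p, and its ghost moves the value at e p back to p. Generators give
    value 0 at lists that are not first passages. *)
Fixpoint act (x : lterm K E) : F -> F :=
  match x with
  | TVertex u => fun xi s =>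
      if first_passage s && (source s == u) then xi s else 0
  | TEdge e => fun xi s =>
      if first_passage s && (ohead (unroll s) == Some e)
      then xi (behead (unroll s)) else 0
  | TGhost e => fun xi s =>
      if first_passage s && (source s == erange e) then xi (prepend e s) else 0
  | TZero => fun _ _ => 0
  | TOpp y => fun xi s => - act y xi s
  | TAdd y z => fun xi s => act y xi s + act z xi s
  | TMul y z => fun xi => act y (act z xi)
  | TScale k y => fun xi s => k * act y xi s
  end.

(** Products act by composition, so distributivity on the right factor needs additivity in the
    function. *)
Lemma act_add x xi eta :
  act x (fun s => xi s + eta s) = (fun s => act x xi s + act x eta s).
Proof.
elim: x xi eta => [u|e|e||x IH|x IHx y IHy|x IHx y IHy|k x IH] xi eta /=;
  try (by rewrite funeqE => s; case: ifP; rewrite ?addr0).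
- by rewrite funeqE => s; rewrite addr0.
- by rewrite IH funeqE => s; rewrite opprD.
- by rewrite IHx IHy funeqE => s; rewrite addrACA.
- by rewrite IHy IHx.
- by rewrite IH funeqE => s; rewrite mulrDr.
Qed.

Lemma act_scale x k xi : act x (fun s => k * xi s) = (fun s => k * act x xi s).
Proof.
elim: x xi => [u|e|e||x IH|x IHx y IHy|x IHx y IHy|k' x IH] xi /=;
  try (by rewrite funeqE => s; case: ifP; rewrite ?mulr0).
- by rewrite funeqE => s; rewrite mulr0.
- by rewrite IH funeqE => s; rewrite mulrN.
- by rewrite IHx IHy funeqE => s; rewrite mulrDr.
- by rewrite IHy IHx.
- by rewrite IH funeqE => s; rewrite mulrCA.
Qed.

(** An infinite path has exactly one first edge, so a single summand contributes. *)
Lemma act_CK2 u :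
  act (TVertex K u) =
  act (\big[@TAdd K E/@TZero K E]_(e : edge E | esource e == u)
         TMul (TEdge K e) (TGhost K e)).
Proof.
rewrite funeqE => xi; rewrite funeqE => s.
rewrite (big_morph (fun x => act x xi s) (fun _ _ => erefl) erefl) /=.
have [fs|nfs] /= := boolP (first_passage s); last by rewrite big1.
have [e [t [-> ft st pt es]]] := unrollP fs; rewrite -es.
case: eqP => [<-|eu].
  rewrite (bigD1 e) //= !eqxx ft st eqxx pt big1 ?addr0 // => f /andP[_ fe].
  by case: eqP => [[ef]|//]; rewrite ef eqxx in fe.
rewrite big1 // => f /eqP fu; case: eqP => // -[ef].
by rewrite ef in eu.
Qed.

Lemma lpa_eq_act x y : lpa_eq x y -> act x = act y.
Proof.
elim=> {x y}; try (by move=> *; rewrite funeqE => xi; rewrite funeqE => s /=;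
  rewrite ?(addrA, add0r, addNr, mulrA, mul1r, mulrDl, mulrDr)).
- by move=> x y _ ->.
- by move=> y x z _ -> _ ->.
- by move=> x x' _ /= ->.
- by move=> x x' y y' _ /= -> _ ->.
- by move=> x x' y y' _ /= -> _ ->.
- by move=> k x x' _ /= ->.
- by move=> x y; rewrite funeqE => xi; rewrite funeqE => s /=; rewrite addrC.
- by move=> x y z; rewrite funeqE => xi; rewrite /= act_add.
- by move=> k x y; rewrite funeqE => xi; rewrite /= act_scale.
- move=> u w uw; rewrite funeqE => xi; rewrite funeqE => s /=.
  by case: ifP => // /andP[_ /eqP su]; rewrite su andbC; case: eqP.
- move=> u; rewrite funeqE => xi; rewrite funeqE => s /=.
  by case: ifP => // ->.
- move=> e; rewrite funeqE => xi; rewrite funeqE => s /=.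
  case: ifP => // /andP[/unrollP[f [t [-> ft st _ _]]] /eqP[fe]] /=.
  by rewrite ft st fe eqxx.
- move=> e; rewrite funeqE => xi; rewrite funeqE => s /=.
  have [fs|//] /= := boolP (first_passage s).
  have [f [t [-> _ _ _ <-]]] := unrollP fs.
  by case: (eqVneq (Some f) (Some e)) => [[->]|]; rewrite ?eqxx ?if_same.
- move=> e; rewrite funeqE => xi; rewrite funeqE => s /=.
  case: ifP => // /andP[fs /eqP se].
  by have [-> -> _] := prependP fs se; rewrite eqxx.
- move=> e; rewrite funeqE => xi; rewrite funeqE => s /=.
  by case: ifP => // ->.
- move=> e f ef; rewrite funeqE => xi; rewrite funeqE => s /=.
  case: ifP => // /andP[fs /eqP se].
  have [-> _ ->] := prependP fs se.
  by case: (eqVneq (Some e) (Some f)) => [[/ef]|].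
- move=> e; rewrite funeqE => xi; rewrite funeqE => s /=.
  case: ifP => // /andP[fs /eqP se].
  by have [-> _ ->] := prependP fs se; rewrite /= eqxx.
- by move=> u _; apply: act_CK2.
Qed.

Definition lpa_act (x : L) : F -> F := act (repr x).

Lemma lpa_actE (x : lterm K E) : lpa_act (\pi_L x) = act x.
Proof. by apply: lpa_eq_act; apply/lpa_piP; rewrite reprK. Qed.

Lemma lpa_actB (x y : L) xi s :
  lpa_act (x - y) xi s = lpa_act x xi s - lpa_act y xi s.
Proof.
by elim/quotW: x => x; elim/quotW: y => y; rewrite -lpa_piN -lpa_piD !lpa_actE.
Qed.

Lemma lpa_actM (x y : L) xi : lpa_act (x * y) xi = lpa_act x (lpa_act y xi).
Proof.
by elim/quotW: x => x; elim/quotW: y => y; rewrite -lpa_piM !lpa_actE.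
Qed.

Lemma lpa_act0 (x : L) : lpa_act x (fun=> 0) = (fun=> 0).
Proof.
(* The zero function is written as a multiple by 0 to bring in [act_scale]. *)
have /(congr1 (lpa_act x)) : (fun s => 0 * 0 : K) = (fun=> 0).
  by rewrite funeqE => s; rewrite mul0r.
rewrite /lpa_act act_scale => <-.
by rewrite funeqE => s; rewrite mul0r.
Qed.

Definition annihilator : set L := fun x => forall xi, lpa_act x xi = (fun=> 0).

Lemma annihilator_ideal : ideal annihilator.
Proof.
split.
- by move=> xi; rewrite -lpa_pi0 lpa_actE.
- by move=> x y Ix Iy xi; rewrite funeqE => s; rewrite lpa_actB Ix Iy subr0.
- by move=> a x Ix xi; rewrite lpa_actM Ix lpa_act0.
- by move=> a x Ix xi; rewrite lpa_actM Ix.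
Qed.

(** On functions supported at one infinite path, an edge just prepends itself. *)
Lemma lpa_act_edge e t x xi a : first_passage t -> source t = erange e ->
  (forall s, lpa_act x xi s = if s == t then a else 0) ->
  forall s, lpa_act (le e * x) xi s = if s == prepend e t then a else 0.
Proof.
move=> ft te xt s; rewrite lpa_actM lpa_actE /= xt.
have [fp _ up] := prependP ft te.
case: (eqVneq s (prepend e t)) => [->|sp]; first by rewrite fp up /= !eqxx.
case: ifP => // /andP[/unrollP[f [t' [-> _ _ pt _]]] /= /eqP[fe]].
by case: eqP => // t't; rewrite -pt fe t't eqxx in sp.
Qed.

Lemma lpa_act_vertex xi s :
  lpa_act (lv v) xi s = if s == [::] then xi [::] else 0.
Proof.
rewrite lpa_actE /=; case: s => [|e s] /=.
  by rewrite /first_passage /= eqxx.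
by case: ifP => // /andP[/walk_first_passage[_ /andP[/negPf ->]]].
Qed.

Lemma lpa_act_real u t xi s : walk u t v -> avoids v t ->
  lpa_act (real K u t) xi s = if s == t then xi [::] else 0.
Proof.
elim: t u s => [|e t IH] u s.
  by move=> /eqP -> _; rewrite real_nil lpa_act_vertex.
move=> /= /andP[/eqP eu wt] /andP[ev at_]; rewrite real_cons //.
have [ft st] := first_passage_walk wt at_.
rewrite (lpa_act_edge ft st (fun s => IH _ s wt at_)).
by rewrite /prepend (negPf ev).
Qed.

(** Both terms send [xi] to [xi [::]] times the indicator of c c c ..., because prepending [c] to
    this path gives it back. *)
Lemma annihilator_cycle : annihilator (lv v - real K v c).
Proof.
move=> xi; rewrite funeqE => s; rewrite lpa_actB lpa_act_vertex.
have := csc; case: c => [|e t]; first by rewrite /cswalk andbF.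
case/and3P=> /andP[/eqP ev wt] _ /= at_; rewrite real_cons //.
have [ft st] := first_passage_walk wt at_.
rewrite (lpa_act_edge ft st (fun s => lpa_act_real xi s wt at_)).
by rewrite /prepend ev eqxx subrr.
Qed.

Lemma annihilator_vertex : ~ annihilator (lv v).
Proof.
move=> /(_ (fun=> 1))/(congr1 (fun h => h [::])).
by rewrite lpa_act_vertex eqxx => /eqP; rewrite oner_eq0.
Qed.

Lemma annihilator_not_graded : ~ graded annihilator.
Proof.
move=> grI; have [wc cN _] := and3P csc.
pose n := (size c)%:Z.
have n0 : n != 0 by rewrite /n; case: (c) cN.
(* The homogeneous parts of v - c lie in degrees 0 and |c|, which differ; all other parts are 0. *)
pose y i : L := if i == 0 then lv v else if i == n then - real K v c else 0.
apply: annihilator_vertex; rewrite -[lv v]/(y 0).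
apply: (grI [:: 0; n]); rewrite ?mem_head //.
- by rewrite /= inE eq_sym n0.
- move=> i; rewrite /y; case: eqP => [->|_].
    exists 1%N, (fun=> 1), (fun=> PVertex v), (fun=> PVertex v); split=> //.
    by rewrite big_ord1 scale1r /= lpa_vertexK.
  case: eqP => [->|_]; last first.
    exists 0%N, (fun=> 0), (fun=> PVertex v), (fun=> PVertex v).
    by split; [case | rewrite big_ord0].
  have [a [pa ca sa ra]] := walk_is_path wc.
  exists 1%N, (fun=> -1), (fun=> a), (fun=> PVertex v); split.
    by move=> _; split=> //; rewrite -size_pedges ca /= subr0.
  by rewrite big_ord1 scaleN1r path_eltE // ca sa /= (real_vertex _ wc).
- rewrite !big_cons big_nil addr0 /y eqxx (negPf n0) eqxx.
  by apply: annihilator_cycle.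
Qed.

End ChenModule.

Theorem theorem2 (K : fieldType) (E : digraph) :
  (forall I : set (LPA K E), ideal I -> graded I) <-> condition_K E.
Proof.
split=> [gr|condK I idI]; last exact: condition_K_graded.
apply/condition_KP => v.
have [[c csc]|no] := pselect (exists c, cswalk v c); last first.
  by left=> s; apply/negP => css; apply: no; exists s.
(* Otherwise [c] is the only closed simple path at [v], and the annihilator of its Chen module
   contradicts [gr]. *)
right; apply: contrapT => no.
have c_unique d : cswalk v d -> d = c.
  by move=> csd; apply: contrapT => dc; apply: no; exists d, c.
apply: (annihilator_not_graded csc c_unique).
exact: gr (annihilator_ideal K csc c_unique).
Qed.
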